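(* Let $U\subset\mathbb{R}^n$ be a domain with $\mathbb{R}^{>0}\cdot U\subset U$ and $h:U\to\mathbb{R}$ a smooth positive function, homogeneous of degree $k>1$, such that $-\partial^2h$ restricts to a positive definite metric on $\{h=1\}$. Assume that the Riemannian metric $g'=-\partial^2\log h$ on $U$ is complete, and let $c<0$. Then the Riemannian metric $g'_c=-\partial^2\log(h+c)$ on $U_c=\{x\in U\mid h(x)+c>0\}$ is complete.
   Context: $\partial^2$ denotes the real Hessian with respect to the standard linear coordinates of $\mathbb{R}^n$. (That $g'$ and $g'_c$ are Riemannian on $U$ and $U_c$ respectively is known in this setting.) *)

(* Defs.v *)
From Stdlib Require Import Reals.
From mathcomp Require Import ssreflect ssrfun ssrbool eqtype ssrnat seq fintype bigop.
Set Implicit Arguments. Unset Strict Implicit.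
Open Scope R_scope.

Definition vec (n : nat) := 'I_n -> R.
Definition vadd {n} (x y : vec n) : vec n := fun i => x i + y i.
Definition vscal {n} (t : R) (x : vec n) : vec n := fun i => t * x i.
Definition vzero {n} : vec n := fun _ => 0.
Definition vbasis {n} (i : 'I_n) : vec n := fun j => if j == i then 1 else 0.
Definition vnorm {n} (x : vec n) : R := sqrt (\big[Rplus/0]_(i < n) (x i * x i)).
Definition vdist {n} (x y : vec n) : R := vnorm (vadd x (vscal (-1) y)).

Definition is_open {n} (U : vec n -> Prop) : Prop :=
  forall x, U x -> exists r, 0 < r /\ forall y, vdist y x < r -> U y.
Definition is_connected {n} (U : vec n -> Prop) : Prop :=
  forall V W : vec n -> Prop, is_open V -> is_open W ->
    (forall x, U x -> V x \/ W x) -> (forall x, ~ (U x /\ V x /\ W x)) ->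
    (exists x, U x /\ V x) -> (exists x, U x /\ W x) -> False.
Definition is_domain {n} (U : vec n -> Prop) : Prop :=
  is_open U /\ is_connected U /\ exists x, U x.

Definition continuous_in {n} (U : vec n -> Prop) (g : vec n -> R) (x : vec n) : Prop :=
  forall eps, 0 < eps -> exists delta, 0 < delta /\
    forall y, U y -> vdist y x < delta -> Rabs (g y - g x) < eps.

Definition smooth_on {n} (U : vec n -> Prop) (f : vec n -> R) : Prop :=
  exists D : seq 'I_n -> vec n -> R,
    (forall x, U x -> D [::] x = f x) /\
    (forall s i x, U x ->
       derivable_pt_lim (fun t => D s (vadd x (vscal t (vbasis i)))) 0 (D (i :: s) x)) /\
    (forall s x, U x -> continuous_in U (D s) x).

Definition dderiv {n} (f : vec n -> R) (x v : vec n) (l : R) : Prop :=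
  derivable_pt_lim (fun t => f (vadd x (vscal t v))) 0 l.

Definition dderiv2 {n} (f : vec n -> R) (x v : vec n) (l : R) : Prop :=
  exists (d : R -> R) (delta : R), 0 < delta /\
    (forall t, Rabs t < delta ->
       derivable_pt_lim (fun s => f (vadd x (vscal s v))) t (d t)) /\
    derivable_pt_lim d 0 l.

(* Riemannian metric g = - d^2 phi (Hessian metric).  [short_path U phi x y eps]:
   there is a C^1 curve in U from x to y whose g-length is < eps. *)
Definition short_path {n} (U : vec n -> Prop) (phi : vec n -> R) (x y : vec n) (eps : R)
  : Prop :=
  exists (gam dgam : R -> vec n) (q : R -> R),
    gam 0 = x /\ gam 1 = y /\
    (forall t, 0 <= t <= 1 -> U (gam t)) /\
    (forall t i, 0 <= t <= 1 -> derivable_pt_lim (fun s => gam s i) t (dgam t i)) /\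
    (forall t i, 0 <= t <= 1 -> continuity_pt (fun s => dgam s i) t) /\
    (forall t, 0 <= t <= 1 -> dderiv2 phi (gam t) (dgam t) (q t)) /\
    exists pr : Riemann_integrable (fun t => sqrt (- q t)) 0 1, RiemannInt pr < eps.

(* Metric completeness of (U, d_g), where d_g(x,y) < eps iff short_path U phi x y eps. *)
Definition hessian_metric_complete {n} (U : vec n -> Prop) (phi : vec n -> R) : Prop :=
  forall u : nat -> vec n, (forall m, U (u m)) ->
    (forall eps, 0 < eps -> exists N : nat, forall m k : nat,
        (N <= m)%nat -> (N <= k)%nat -> short_path U phi (u m) (u k) eps) ->
    exists p, U p /\ forall eps, 0 < eps -> exists N : nat, forall m : nat,
        (N <= m)%nat -> short_path U phi (u m) p eps.

(* Main.v *)
(** Write [P] and [Q] for the first and second directional derivatives of [h] at [x]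
    along [v]. Splitting [v] into a radial part and a part tangent to the level set of
    [h], Euler's identities and the definiteness assumption give
    [Q <= (k - 1) / k * P^2 / h]. From this inequality alone one gets, for [c <= 0]:
    - [g'_c >= g'], so a [g'_c]-Cauchy sequence [u] is [g']-Cauchy and has a [g']-limit [p];
    - [ln (h + c)] is [sqrt k]-Lipschitz for [g'_c], so eventually [h + c >= e > 0] on [u],
      and [ln h] is [sqrt k]-Lipschitz for [g'], so [h + c >= e / 2] all along short
      [g']-curves from [u m] to [p];
    - where [h + c >= m > 0], [g'_c <= k (1 - c / m)^2 g'], so these curves are also
      [g'_c]-short. *)

Require Import Defs.
From Stdlib Require Import Reals Lra Classical FunctionalExtensionality.
From Coquelicot Require Import Coquelicot.
From mathcomp Require Import ssreflect ssrfun ssrbool eqtype ssrnat seq fintype bigop.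
From mathcomp Require Import Rstruct.
Set Implicit Arguments. Unset Strict Implicit.
Open Scope R_scope.

(** * Finite sums and bilinear forms *)

Lemma Rsum_le I (r : seq I) (F G : I -> R) : (forall i, F i <= G i) ->
  \big[Rplus/0]_(i <- r) F i <= \big[Rplus/0]_(i <- r) G i.
Proof. by move=> FG; elim/big_ind2: _ => // *; lra. Qed.

Lemma is_derive_Rsum I (r : seq I) (F : I -> R -> R) (dF : I -> R) t :
  (forall i, is_derive (F i) t (dF i)) ->
  is_derive (fun s => \big[Rplus/0]_(i <- r) F i s) t (\big[Rplus/0]_(i <- r) dF i).
Proof.
move=> hF; elim: r => [|i r IH].
  rewrite big_nil; apply: (is_derive_ext (fun=> 0)) => [s|]; first by rewrite big_nil.
  exact: is_derive_const.
rewrite big_cons.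
apply: (is_derive_ext (fun s => plus (F i s) (\big[Rplus/0]_(j <- r) F j s))) => [s|].
  by rewrite big_cons.
exact: is_derive_plus.
Qed.

Lemma continuity_pt_Rsum I (r : seq I) (F : I -> R -> R) t :
  (forall i, continuity_pt (F i) t) ->
  continuity_pt (fun s => \big[Rplus/0]_(i <- r) F i s) t.
Proof.
move=> hF; elim: r => [|i r IH].
  by apply: (continuity_pt_ext (fun=> 0)) => [s|]; [rewrite big_nil | exact: continuity_pt_const].
apply: (continuity_pt_ext (fun s => F i s + \big[Rplus/0]_(j <- r) F j s)) => [s|].
  by rewrite big_cons.
exact: continuity_pt_plus.
Qed.

Definition dot {n} (a v : vec n) : R := \big[Rplus/0]_(i < n) (a i * v i).

Definition bilin {n} (A : 'I_n -> vec n) (v w : vec n) : R := dot (fun i => dot (A i) v) w.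

Lemma dotC n (a v : vec n) : dot a v = dot v a.
Proof. by apply: eq_bigr => i _; rewrite Rmult_comm. Qed.

Lemma dotDr n (a v w : vec n) : dot a (vadd v w) = dot a v + dot a w.
Proof. by rewrite -big_split; apply: eq_bigr => i _ /=; rewrite /vadd; lra. Qed.

Lemma dotZr n t (a v : vec n) : dot a (vscal t v) = t * dot a v.
Proof. by rewrite /dot big_distrr; apply: eq_bigr => i _ /=; rewrite /vscal; lra. Qed.

Lemma dot0r n (a : vec n) : dot a vzero = 0.
Proof. by rewrite /dot big1 // => i _; rewrite /vzero; lra. Qed.

Lemma bilin_quadraticDZ n (A : 'I_n -> vec n) a x w :
  bilin A (vadd (vscal a x) w) (vadd (vscal a x) w) =
  a ^ 2 * bilin A x x + a * (bilin A x w + bilin A w x) + bilin A w w.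
Proof.
have row u : bilin A (vadd (vscal a x) w) u = a * bilin A x u + bilin A w u.
  rewrite /bilin !(dotC _ u) -dotZr -dotDr; congr dot.
  by apply: functional_extensionality => i; rewrite dotDr dotZr.
by rewrite row /bilin !dotDr !dotZr; ring.
Qed.

Lemma continuity_pt_dot n (a v : R -> vec n) t :
  (forall i, continuity_pt (fun s => a s i) t) ->
  (forall i, continuity_pt (fun s => v s i) t) ->
  continuity_pt (fun s => dot (a s) (v s)) t.
Proof.
move=> ca cv; apply: (continuity_pt_Rsum _ (F := fun i s => a s i * v s i)) => i.
exact: continuity_pt_mult.
Qed.

Lemma vnorm_le n (x y : vec n) : (forall i, Rabs (x i) <= Rabs (y i)) -> vnorm x <= vnorm y.
Proof. by move=> xy; apply: sqrt_le_1_alt; apply: Rsum_le => i; apply: Rsqr_le_abs_1. Qed.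

Lemma vdistxx n (x : vec n) : vdist x x = 0.
Proof. by rewrite /vdist /vnorm big1 ?sqrt_0 // => i _; rewrite /vadd /vscal; ring. Qed.

(** * Curves and directional derivatives *)

Section Curve.
Context (n : nat) (g : R -> vec n) (t : R).

Definition curve_continuous : Prop := forall i, continuity_pt (fun s => g s i) t.

Definition curve_derivative (dg : vec n) : Prop :=
  forall i, derivable_pt_lim (fun s => g s i) t (dg i).

Lemma curve_derivative_continuous dg : curve_derivative dg -> curve_continuous.
Proof. by move=> hg i; apply: derivable_continuous_pt; exists (dg i); exact: hg. Qed.

Hypothesis g_cont : curve_continuous.

Lemma locally_vdist_lt r : 0 < r -> locally t (fun s => vdist (g s) (g t) < r).
Proof.
move=> r0.
have : continuity_pt (fun s => vdist (g s) (g t)) t.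
  apply/continuity_pt_filterlim; apply: continuous_sqrt_comp.
  apply/continuity_pt_filterlim.
  apply: (continuity_pt_dot (a := fun s => vadd (g s) _)) => i;
    by apply: continuity_pt_plus => //; apply: continuity_pt_const.
move=> /continuity_pt_locally /(_ (mkposreal _ r0)); apply: filter_imp => s /=.
by rewrite vdistxx Rminus_0_r; exact: Rle_lt_trans (Rle_abs _).
Qed.

Lemma locally_open (U : vec n -> Prop) : is_open U -> U (g t) -> locally t (fun s => U (g s)).
Proof.
by move=> openU /openU [r [r0 hr]]; apply: filter_imp (locally_vdist_lt r0) => s /hr.
Qed.

Lemma continuity_pt_along (U : vec n -> Prop) f :
  is_open U -> U (g t) -> continuous_in U f (g t) -> continuity_pt (fun s => f (g s)) t.
Proof.
move=> openU Ut cf; apply/continuity_pt_locally => eps.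
have [d [d0 hd]] := cf _ (cond_pos eps).
apply: filter_imp (filter_and _ _ (locally_open openU Ut) (locally_vdist_lt d0)) => s [].
exact: hd.
Qed.

End Curve.

Lemma vadd_scal0 n (x v : vec n) : vadd x (vscal 0 v) = x.
Proof. by apply: functional_extensionality => i; rewrite /vadd /vscal; lra. Qed.

Lemma line_derivative n (x v : vec n) t : curve_derivative (fun s => vadd x (vscal s v)) t v.
Proof. by move=> i; apply/is_derive_Reals; rewrite /vadd /vscal; auto_derive; lra. Qed.

Lemma locally_open_line n (U : vec n -> Prop) x v : is_open U -> U x ->
  locally 0 (fun s => U (vadd x (vscal s v))).
Proof.
move=> openU Ux.
apply: (locally_open (g := fun s => vadd x (vscal s v))) openU _; last by rewrite vadd_scal0.
exact: curve_derivative_continuous (line_derivative x v 0).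
Qed.

Lemma is_derive_line n (f : vec n -> R) x v t l :
  dderiv f (vadd x (vscal t v)) v l -> is_derive (fun s => f (vadd x (vscal s v))) t l.
Proof.
move=> /is_derive_Reals hf; rewrite -[l]Rmult_1_l.
apply: (is_derive_ext (fun s => f (vadd (vadd x (vscal t v)) (vscal (s - t) v)))) => [s|].
  by congr f; apply: functional_extensionality => i; rewrite /vadd /vscal; lra.
apply: (is_derive_comp (fun u => f (vadd (vadd x (vscal t v)) (vscal u v)))).
  by rewrite Rminus_diag.
by auto_derive; lra.
Qed.

Lemma is_derive_line0 n (f : vec n -> R) x v l :
  dderiv f x v l -> is_derive (fun s => f (vadd x (vscal s v))) 0 l.
Proof. by move=> hf; apply: is_derive_line; rewrite vadd_scal0. Qed.

Lemma dderiv_unique n (f : vec n -> R) x v l l' : dderiv f x v l -> dderiv f x v l' -> l = l'.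
Proof. exact: uniqueness_limite. Qed.

Lemma dderiv_ext_open n (U : vec n -> Prop) f g x v l : is_open U -> U x ->
  (forall y, U y -> f y = g y) -> dderiv f x v l -> dderiv g x v l.
Proof.
move=> openU Ux fg /is_derive_Reals hf; apply/is_derive_Reals.
apply: is_derive_ext_loc hf.
by apply: filter_imp (locally_open_line v openU Ux) => s /fg.
Qed.

Lemma dderiv2P n (f : vec n -> R) x v l :
  dderiv2 f x v l <->
  exists2 d : R -> R,
    locally 0 (fun t => is_derive (fun s => f (vadd x (vscal s v))) t (d t)) & is_derive d 0 l.
Proof.
have ball0 e t : ball 0 e t <-> Rabs t < e by rewrite -{2}[t]Rminus_0_r.
split=> [[d [e [e0 [hd hl]]]]|[d [[e e0] hd] hl]].
  exists d; last exact/is_derive_Reals.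
  by exists (mkposreal _ e0) => t /ball0 /hd /is_derive_Reals.
exists d, e; split=> //; split; last exact/is_derive_Reals.
by move=> t /ball0 /hd /is_derive_Reals.
Qed.

Lemma dderiv2_unique n (f : vec n -> R) x v l l' :
  dderiv2 f x v l -> dderiv2 f x v l' -> l = l'.
Proof.
move=> /dderiv2P [d hd hl] /dderiv2P [d' hd' hl'].
rewrite -(is_derive_unique _ _ _ hl'); apply/esym/is_derive_unique.
apply: is_derive_ext_loc hl; apply: filter_imp (filter_and _ _ hd hd') => t [].
by move=> /is_derive_unique <- /is_derive_unique.
Qed.

(** * The chain rule *)

Definition C1_gradient {n} (U : vec n -> Prop) (f : vec n -> R) (df : vec n -> vec n) : Prop :=
  (forall x i, U x -> dderiv f x (vbasis i) (df x i)) /\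
  (forall x i, U x -> continuous_in U (fun y => df y i) x).

(* The corners of the axis-parallel path from [x] to [y]. *)
Definition splice {n} (x y : vec n) (j : nat) : vec n := fun i => if (i < j)%N then y i else x i.

Lemma spliceS n (x y : vec n) (i : 'I_n) :
  splice x y i.+1 = vadd (splice x y i) (vscal (y i - x i) (vbasis i)).
Proof.
apply: functional_extensionality => j; rewrite /vadd /vscal /splice /vbasis ltnS.
case: (eqVneq j i) => [->|ji]; first by rewrite ltnn leqnn; lra.
by rewrite [(j <= i)%N]leq_eqVlt -[(_ == _ :> nat)]/(j == i) (negbTE ji) /=; case: ifP; lra.
Qed.

Lemma vdist_splice_axis n (x y : vec n) (i : 'I_n) t : Rabs t <= Rabs (y i - x i) ->
  vdist (vadd (splice x y i) (vscal t (vbasis i))) x <= vdist y x.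
Proof.
move=> ht; apply: vnorm_le => j; rewrite /vadd /vscal /splice /vbasis.
case: (eqVneq j i) => [->|_].
  rewrite ltnn (_ : _ + _ + _ = t); last by lra.
  by rewrite (_ : y i + _ = y i - x i) //; lra.
case: ifP => _; first by right; congr Rabs; lra.
by rewrite (_ : _ + _ + _ = 0) ?Rabs_R0; [exact: Rabs_pos|lra].
Qed.

Lemma Rsum_splice n (f : vec n -> R) x y :
  f y - f x = \big[Rplus/0]_(i < n) (f (splice x y i.+1) - f (splice x y i)).
Proof.
have telescope (a : nat -> R) m : \big[Rplus/0]_(i < m) (a i.+1 - a i) = a m - a 0%N.
  by elim: m => [|m IH]; rewrite ?big_ord0 ?big_ord_recr /= ?IH; lra.
rewrite (telescope (fun j => f (splice x y j))); congr (f _ - f _);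
  by apply: functional_extensionality => i; rewrite /splice ?ltn_ord.
Qed.

Lemma C1_gradient_splice_approx n (U : vec n -> Prop) f df x (i : 'I_n) eps :
  is_open U -> C1_gradient U f df -> U x -> 0 < eps ->
  exists r, 0 < r /\ forall y, vdist y x < r ->
    Rabs (f (splice x y i.+1) - f (splice x y i) - df x i * (y i - x i))
      <= eps * Rabs (y i - x i).
Proof.
move=> openU [hf cdf] Ux eps0.
have [r [r0 ball_U]] := openU _ Ux.
have [d [d0 df_close]] := cdf x i Ux _ eps0.
exists (Rmin r d); split=> [|y yx]; first exact: Rmin_glb_lt.
pose p t := vadd (splice x y i) (vscal t (vbasis i)).
have near t : Rabs t <= Rabs (y i - x i) -> U (p t) /\ Rabs (df (p t) i - df x i) < eps.
  move=> /vdist_splice_axis pt.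
  move: (Rmin_l r d) (Rmin_r r d) => rd_r rd_d.
  have Up : U (p t) by apply: ball_U; rewrite /p; lra.
  by split=> //; apply: df_close => //; rewrite /p; lra.
rewrite spliceS -[X in f _ - f X - _](vadd_scal0 _ (vbasis i)).
have := @bounded_variation (fun t => f (p t) - df x i * t) (fun t => df (p t) i - df x i)
  eps 0 (y i - x i).
rewrite !Rminus_0_r Rmult_0_r Rminus_0_r -/(p _) -/(p _) => bv.
rewrite (_ : f _ - f _ - _ = f (p (y i - x i)) - df x i * (y i - x i) - f (p 0)); last by lra.
apply: bv => t; rewrite Rminus_0_r => /near [Up close]; split; last exact: Rlt_le.
apply: is_derive_minus; first by apply: is_derive_line; exact: hf.
by auto_derive; lra.
Qed.

Lemma is_derive_approx (F u : R -> R) t a du : is_derive u t du -> u t = 0 ->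
  (forall eps, 0 < eps -> locally t (fun s => Rabs (F s - a * u s) <= eps * Rabs (u s))) ->
  is_derive F t (a * du).
Proof.
move=> hu ut approx.
have Ft : F t = 0.
  have := locally_singleton _ _ (approx 1 Rlt_0_1).
  rewrite ut Rabs_R0 !Rmult_0_r Rminus_0_r => F0.
  by apply: Rabs_eq_0; apply: Rle_antisym F0 (Rabs_pos _).
suff rem : is_derive (fun s => F s - a * u s) t 0.
  apply: (is_derive_ext (fun s => plus (F s - a * u s) (a * u s))) => [s|].
    by rewrite /plus /=; lra.
  rewrite -[a * du]Rplus_0_l; apply: is_derive_plus rem _.
  exact: is_derive_scal.
split=> [|_ /is_filter_lim_locally_unique <- [eps eps0]]; first exact: is_linear_scal_l.
have C0 : 0 < Rabs du + 1 by move: (Rabs_pos du); lra.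
have [_ /(_ t (fun P HP => HP) (mkposreal _ Rlt_0_1)) du_close] := hu.
apply: filter_imp (filter_and _ _ du_close (approx _ (Rdiv_lt_0_compat _ _ eps0 C0))) => s.
rewrite /norm /= /abs /minus /plus /opp /scal /= /mult /= ut Ft.
rewrite Rmult_1_l => -[u_close F_close].
have u_le : Rabs (u s) <= (Rabs du + 1) * Rabs (s + - t).
  have := Rabs_triang (u s + - 0 + - ((s + - t) * du)) ((s + - t) * du).
  by rewrite Rabs_mult (_ : _ + - 0 + _ + _ = u s); lra.
rewrite (_ : _ + - _ + - _ = F s - a * u s); last by lra.
apply: Rle_trans F_close _.
apply: Rle_trans (Rmult_le_compat_l _ _ _ _ u_le) _.
  by apply: Rlt_le; apply: Rdiv_lt_0_compat.
by right; field; lra.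
Qed.

Lemma chain_rule n (U : vec n -> Prop) f df (g : R -> vec n) dg t :
  is_open U -> C1_gradient U f df -> U (g t) -> curve_derivative g t dg ->
  is_derive (fun s => f (g s)) t (dot (df (g t)) dg).
Proof.
move=> openU hf Ut hg; have cg := curve_derivative_continuous hg.
apply: (is_derive_ext (fun s => plus (f (g s) - f (g t)) (f (g t)))) => [s|].
  by rewrite /plus /=; lra.
rewrite -[dot _ _]Rplus_0_r; apply: is_derive_plus (is_derive_const _ _).
apply: is_derive_ext => [s|]; first by rewrite (Rsum_splice f (g t)).
apply: is_derive_Rsum => i.
apply: (is_derive_approx (u := fun s => g s i - g t i)).
- rewrite -[dg i]Rminus_0_r; apply: is_derive_minus (is_derive_const _ _).
  exact/is_derive_Reals.
- exact: Rminus_diag.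
- move=> eps eps0.
  have [r [r0 approx]] := C1_gradient_splice_approx i openU hf Ut eps0.
  by apply: filter_imp (locally_vdist_lt cg r0) => s /approx.
Qed.

Lemma C1_gradient_dderiv n (U : vec n -> Prop) f df x v :
  is_open U -> C1_gradient U f df -> U x -> dderiv f x v (dot (df x) v).
Proof.
move=> openU hf Ux; apply/is_derive_Reals; rewrite -{2}(vadd_scal0 x v).
apply: (chain_rule (g := fun s => vadd x (vscal s v)) openU hf); first by rewrite vadd_scal0.
exact: line_derivative.
Qed.

Definition C2_jet {n} (U : vec n -> Prop) (f : vec n -> R)
    (df : vec n -> vec n) (ddf : vec n -> 'I_n -> vec n) : Prop :=
  C1_gradient U f df /\ forall i, C1_gradient U (fun x => df x i) (fun x => ddf x i).

Lemma smooth_on_C2_jet n (U : vec n -> Prop) f :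
  is_open U -> smooth_on U f -> exists df ddf, C2_jet U f df ddf.
Proof.
move=> openU [D [D0 [D1 Dc]]].
exists (fun x i => D [:: i] x), (fun x i j => D [:: j; i] x); split=> [|i]; last first.
  by split=> x j Ux; [exact: D1 | exact: Dc].
split=> x i Ux; last exact: Dc.
exact: dderiv_ext_open openU Ux D0 (D1 [::] i x Ux).
Qed.

Lemma C2_jet_dderiv_gradient n (U : vec n -> Prop) f df ddf x v w :
  is_open U -> C2_jet U f df ddf -> U x ->
  dderiv (fun y => dot (df y) w) x v (bilin (ddf x) v w).
Proof.
move=> openU [_ hdf] Ux; apply/is_derive_Reals.
apply: (is_derive_Rsum _ (F := fun i s => df (vadd x (vscal s v)) i * w i)) => i.
have := C1_gradient_dderiv v openU (hdf i) Ux => /is_derive_Reals /(is_derive_scal_l _ _ _ (w i)).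
exact.
Qed.

Lemma C2_jet_dderiv2 n (U : vec n -> Prop) f df ddf x v :
  is_open U -> C2_jet U f df ddf -> U x -> dderiv2 f x v (bilin (ddf x) v v).
Proof.
move=> openU hf Ux; apply/dderiv2P; exists (fun t => dot (df (vadd x (vscal t v))) v).
  apply: filter_imp (locally_open_line v openU Ux) => t Ut.
  by apply: is_derive_line; exact: C1_gradient_dderiv openU (proj1 hf) Ut.
by apply/is_derive_Reals; exact: C2_jet_dderiv_gradient openU hf Ux.
Qed.

(** * Homogeneous functions *)

Definition homogeneous_on {n} (U : vec n -> Prop) (a : R) (f : vec n -> R) : Prop :=
  forall t x, 0 < t -> U x -> f (vscal t x) = Rpower t a * f x.

Section Homogeneous.
Context (n : nat) (U : vec n -> Prop).
Hypothesis openU : is_open U.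
Hypothesis cone : forall t x, 0 < t -> U x -> U (vscal t x).

Lemma homogeneous_on_dderiv a f f' v : homogeneous_on U a f ->
  (forall x, U x -> dderiv f x v (f' x)) -> homogeneous_on U (a - 1) f'.
Proof.
move=> hom hf t x t0 Ux; apply: (dderiv_unique (hf _ (cone t0 Ux))).
pose ft y := Rpower t a * f (vscal (/ t) y).
apply: (dderiv_ext_open (f := ft) openU (cone t0 Ux)) => [y Uy|].
  have ti0 : 0 < / t by exact: Rinv_0_lt_compat.
  rewrite /ft -hom //; last exact: cone.
  by congr f; apply: functional_extensionality => i; rewrite /vscal; field; lra.
apply/is_derive_Reals; rewrite /Rminus Rpower_plus Rpower_Ropp Rpower_1 // Rmult_assoc.
apply: is_derive_scal.
apply: (is_derive_ext (fun s => f (vadd x (vscal (s / t) v)))) => [s|].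
  by congr f; apply: functional_extensionality => i; rewrite /vadd /vscal; field; lra.
apply: (is_derive_comp (fun u => f (vadd x (vscal u v))) (fun s => s / t)).
  by rewrite /Rdiv Rmult_0_l; apply: is_derive_line0; exact: hf.
by auto_derive; [|field]; lra.
Qed.

Lemma homogeneous_on_euler a f x l : homogeneous_on U a f -> U x ->
  dderiv f x x l -> l = a * f x.
Proof.
move=> hom Ux hl; apply: (dderiv_unique hl); apply/is_derive_Reals.
apply: (is_derive_ext_loc (fun s => Rpower (1 + s) a * f x)).
  have s_gt : locally 0 (fun s => -1 < s) by apply: open_gt; lra.
  apply: filter_imp s_gt => s s1; rewrite -hom //; last by lra.
  by congr f; apply: functional_extensionality => i; rewrite /vadd /vscal; lra.
rewrite /Rpower; auto_derive; first by lra.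
by rewrite Rplus_0_r ln_1 Rmult_0_r exp_0; field.
Qed.

Section SecondOrder.
Context (a : R) (f : vec n -> R) (df : vec n -> vec n) (ddf : vec n -> 'I_n -> vec n).
Hypothesis hom : homogeneous_on U a f.
Hypothesis jet : C2_jet U f df ddf.

Lemma homogeneous_on_gradient v : homogeneous_on U (a - 1) (fun x => dot (df x) v).
Proof. by apply: homogeneous_on_dderiv hom _ => x; apply: C1_gradient_dderiv; case: jet. Qed.

Lemma homogeneous_on_hessian v w : homogeneous_on U (a - 1 - 1) (fun x => bilin (ddf x) v w).
Proof.
apply: homogeneous_on_dderiv (homogeneous_on_gradient w) _ => x.
exact: C2_jet_dderiv_gradient jet.
Qed.

Lemma gradient_radial x : U x -> dot (df x) x = a * f x.
Proof.
move=> Ux; apply: (homogeneous_on_euler hom Ux).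
exact: C1_gradient_dderiv openU (proj1 jet) Ux.
Qed.

Lemma hessian_radial_l x w : U x -> bilin (ddf x) x w = (a - 1) * dot (df x) w.
Proof.
move=> Ux; apply: (homogeneous_on_euler (homogeneous_on_gradient w) Ux).
exact: C2_jet_dderiv_gradient jet Ux.
Qed.

(* Differentiating Euler's identity [dot (df y) y = a * f y] along [w] replaces the
   symmetry of the second derivatives. *)
Lemma hessian_radial_r x w : U x -> bilin (ddf x) w x = (a - 1) * dot (df x) w.
Proof.
move=> Ux; pose y s := vadd x (vscal s w).
have d_grad u : is_derive (fun s => dot (df (y s)) u) 0 (bilin (ddf x) w u).
  by apply: (is_derive_line0 (f := fun z => dot (df z) u)); exact: C2_jet_dderiv_gradient jet Ux.
have d_euler : is_derive (fun s => dot (df (y s)) (y s)) 0 (bilin (ddf x) w x + dot (df x) w).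
  apply: (is_derive_ext (fun s => plus (dot (df (y s)) x) (s * dot (df (y s)) w))) => [s|].
    by rewrite dotDr dotZr.
  apply: is_derive_plus => //.
  have -> : dot (df x) w = 1 * dot (df (y 0)) w + 0 * bilin (ddf x) w w.
    by rewrite /y vadd_scal0; lra.
  by apply: is_derive_mult => //; [exact: is_derive_id | exact: Rmult_comm].
suff : bilin (ddf x) w x + dot (df x) w = a * dot (df x) w by lra.
rewrite -(is_derive_unique _ _ _ d_euler); apply: is_derive_unique.
apply: (is_derive_ext_loc (fun s => a * f (y s))).
  by apply: filter_imp (locally_open_line w openU Ux) => s /gradient_radial.
apply: is_derive_scal; apply: is_derive_line0; exact: C1_gradient_dderiv openU (proj1 jet) Ux.
Qed.

End SecondOrder.
End Homogeneous.

Section NegHessianBound.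
Context (n : nat) (U : vec n -> Prop) (h : vec n -> R) (k : R).
Context (dh : vec n -> vec n) (ddh : vec n -> 'I_n -> vec n).
Hypothesis openU : is_open U.
Hypothesis cone : forall t x, 0 < t -> U x -> U (vscal t x).
Hypothesis h_pos : forall x, U x -> 0 < h x.
Hypothesis k_neq0 : k <> 0.
Hypothesis hom : homogeneous_on U k h.
Hypothesis jet : C2_jet U h dh ddh.
Hypothesis neg_def : forall x v l, U x -> h x = 1 -> dderiv h x v 0 -> v <> vzero ->
  dderiv2 h x v l -> 0 < - l.

Lemma hessian_tangent_le0 x w : U x -> dot (dh x) w = 0 -> bilin (ddh x) w w <= 0.
Proof.
move=> Ux gw; have hx := h_pos Ux.
case: (classic (w = vzero)) => [->|w0]; first by rewrite /bilin dot0r; lra.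
pose m := Rpower (h x) (- / k).
have m0 : 0 < m by exact: exp_pos.
have Umx := cone m0 Ux.
suff : 0 < - bilin (ddh (vscal m x)) w w.
  rewrite (homogeneous_on_hessian openU cone hom jet) // => scaled_gt0.
  by have := exp_pos ((k - 1 - 1) * ln m); rewrite -/(Rpower _ _); nra.
apply: (neg_def Umx _ _ w0 (C2_jet_dderiv2 w openU jet Umx)).
  rewrite hom // /m Rpower_mult (_ : - / k * k = -1); last by field.
  by rewrite Rpower_Ropp Rpower_1 //; field; lra.
have := C1_gradient_dderiv w openU (proj1 jet) Umx.
by rewrite (homogeneous_on_gradient openU cone hom jet) // gw Rmult_0_r.
Qed.

Lemma hessian_le_gradient_sqr x v : U x ->
  bilin (ddh x) v v <= (k - 1) / k * (dot (dh x) v ^ 2 / h x).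
Proof.
move=> Ux; have hx : h x <> 0 by have := h_pos Ux; lra.
pose a := dot (dh x) v / (k * h x).
pose w := vadd v (vscal (- a) x).
have gx := gradient_radial openU hom jet Ux.
have gw : dot (dh x) w = 0 by rewrite dotDr dotZr gx /a; field.
have -> : v = vadd (vscal a x) w.
  by apply: functional_extensionality => i; rewrite /w /vadd /vscal; lra.
rewrite bilin_quadraticDZ dotDr dotZr.
rewrite (hessian_radial_r openU hom jet w) // !(hessian_radial_l openU cone hom jet) // gw gx.
have := hessian_tangent_le0 Ux gw.
rewrite (_ : (k - 1) / k * _ = a ^ 2 * ((k - 1) * (k * h x))); first by lra.
by field.
Qed.

End NegHessianBound.

(** * Minus the second derivative of a logarithm *)

(* The value of [- (ln f)''] where [f = y], [f' = p] and [f'' = q]. *)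
Definition neg_dln2 (y p q : R) : R := (p / y) ^ 2 - q / y.

Section NegDln2.
Context (k y y' p q : R).
Hypothesis k_gt1 : 1 < k.
Hypothesis y'_gt0 : 0 < y'.
Hypothesis y'_le : y' <= y.
Hypothesis q_le : q <= (k - 1) / k * (p ^ 2 / y).

Let defect := (k - 1) / k * (p ^ 2 / y) - q.

Lemma neg_dln2_split z : 0 < z ->
  neg_dln2 z p q = p ^ 2 * (/ z * (/ z - (k - 1) / k * / y)) + defect * / z.
Proof. by move=> z0; rewrite /neg_dln2 /defect; field; lra. Qed.

Let inv_defect_bounds : [/\ 0 < / y, / y <= / y' & 0 <= defect].
Proof.
split; [by apply: Rinv_0_lt_compat; lra | exact: Rinv_le_contravar | by rewrite /defect; lra].
Qed.

Lemma neg_dln2_antimono : neg_dln2 y p q <= neg_dln2 y' p q.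
Proof.
have [inv_gt0 inv_le defect_ge0] := inv_defect_bounds.
have ratio : (k - 1) / k <= 1 by apply/Rcomplements.Rle_div_l; lra.
rewrite !neg_dln2_split; try lra.
apply: Rplus_le_compat; apply: Rmult_le_compat_l => //; first exact: pow2_ge_0.
by apply: Rmult_le_compat; nra.
Qed.

Lemma dln_sqr_le_neg_dln2 : (p / y') ^ 2 <= k * neg_dln2 y' p q.
Proof.
have [inv_gt0 inv_le defect_ge0] := inv_defect_bounds.
rewrite neg_dln2_split //.
have -> : k * (p ^ 2 * (/ y' * (/ y' - (k - 1) / k * / y)) + defect * / y') =
    (p / y') ^ 2 + (k - 1) * (p ^ 2 * (/ y' * (/ y' - / y))) + k * (defect * / y').
  by field; lra.
have p2 := pow2_ge_0 p.
have : 0 <= (k - 1) * (p ^ 2 * (/ y' * (/ y' - / y))).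
  by repeat (apply: Rmult_le_pos; try lra).
have : 0 <= k * (defect * / y') by repeat (apply: Rmult_le_pos; try lra).
by lra.
Qed.

Lemma neg_dln2_le_scal r : 1 <= r -> y <= r * y' ->
  neg_dln2 y' p q <= k * r ^ 2 * neg_dln2 y p q.
Proof.
move=> r1 yr.
have [inv_gt0 inv_le defect_ge0] := inv_defect_bounds.
have a0 : 0 < (k - 1) / k by apply: Rdiv_lt_0_compat; lra.
have inv_le_r : / y' <= r * / y.
  have -> : / y' = y * / (y * y') by field; lra.
  have -> : r * / y = r * y' * / (y * y') by field; lra.
  apply: Rmult_le_compat_r => //; apply: Rlt_le; apply: Rinv_0_lt_compat.
  by apply: Rmult_lt_0_compat; lra.
have p2 := pow2_ge_0 p.
rewrite !neg_dln2_split; try lra.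
have -> : k * r ^ 2 * (p ^ 2 * (/ y * (/ y - (k - 1) / k * / y)) + defect * / y) =
    p ^ 2 * (r * / y) ^ 2 + k * r * (defect * (r * / y)) by field; lra.
apply: Rplus_le_compat.
  apply: Rmult_le_compat_l => //; apply: (Rle_trans _ ((/ y') ^ 2)); last by apply: pow_incr; lra.
  have : 0 <= / y' * ((k - 1) / k * / y) by repeat (apply: Rmult_le_pos; try lra).
  by lra.
apply: (Rle_trans _ (defect * (r * / y))); first exact: Rmult_le_compat_l.
rewrite -[X in X <= _]Rmult_1_l; apply: Rmult_le_compat_r; last by nra.
by apply: Rmult_le_pos => //; nra.
Qed.

End NegDln2.

(** * Lengths of curves for Hessian metrics *)

Definition C1_curve {n} (W : vec n -> Prop) (gam dgam : R -> vec n) : Prop :=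
  forall t, 0 <= t <= 1 ->
    [/\ W (gam t), curve_derivative gam t (dgam t) & curve_continuous dgam t].

Definition continuous_along_curves {n} (W : vec n -> Prop) (g : vec n -> vec n -> R) : Prop :=
  forall gam dgam t, C1_curve W gam dgam -> 0 <= t <= 1 ->
    continuity_pt (fun s => g (gam s) (dgam s)) t.

Definition C1_differential {n} (W : vec n -> Prop) (f : vec n -> R)
    (df : vec n -> vec n -> R) : Prop :=
  (forall gam dgam t, C1_curve W gam dgam -> 0 <= t <= 1 ->
     is_derive (fun s => f (gam s)) t (df (gam t) (dgam t))) /\
  continuous_along_curves W df.

Definition neg_hessian {n} (W : vec n -> Prop) (phi : vec n -> R)
    (g : vec n -> vec n -> R) : Prop :=
  (forall x v, W x -> dderiv2 phi x v (- g x v)) /\ continuous_along_curves W g.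

Section Subdomain.
Context (n : nat) (W W' : vec n -> Prop).
Hypothesis WW' : forall x, W x -> W' x.

Lemma C1_curve_sub gam dgam : C1_curve W gam dgam -> C1_curve W' gam dgam.
Proof. by move=> hgam t /hgam [/WW']. Qed.

Lemma continuous_along_curves_sub g :
  continuous_along_curves W' g -> continuous_along_curves W g.
Proof. by move=> cg gam dgam t /C1_curve_sub; exact: cg. Qed.

Lemma C1_differential_sub f df : C1_differential W' f df -> C1_differential W f df.
Proof.
move=> [hf cdf]; split=> [gam dgam t /C1_curve_sub|]; first exact: hf.
exact: continuous_along_curves_sub.
Qed.

Lemma neg_hessian_sub phi g : neg_hessian W' phi g -> neg_hessian W phi g.
Proof.
move=> [hg cg]; split=> [x v /WW'|]; first exact: hg.
exact: continuous_along_curves_sub.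
Qed.

End Subdomain.

Definition speed {n} (g : vec n -> vec n -> R) (gam dgam : R -> vec n) (t : R) : R :=
  sqrt (g (gam t) (dgam t)).

Section HessianLength.
Context (n : nat) (W : vec n -> Prop) (phi : vec n -> R) (g : vec n -> vec n -> R).
Hypothesis hess_g : neg_hessian W phi g.

Lemma ex_RInt_speed gam dgam a b : C1_curve W gam dgam -> 0 <= a <= b -> b <= 1 ->
  ex_RInt (speed g gam dgam) a b.
Proof.
move=> hgam ab b1; apply: ex_RInt_continuous => t.
rewrite Rmin_left ?Rmax_right; try lra; move=> t_ab.
apply: continuous_sqrt_comp; apply/continuity_pt_filterlim.
by case: hess_g => _; apply=> //; lra.
Qed.

Lemma short_pathP x y eps :
  short_path W phi x y eps <->
  exists gam dgam, [/\ gam 0 = x, gam 1 = y, C1_curve W gam dgam &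
    RInt (speed g gam dgam) 0 1 < eps].
Proof.
split=> [[gam [dgam [q [g0 [g1 [gW [dg [cg [hq [pr len]]]]]]]]]]|[gam [dgam [g0 g1 hgam len]]]].
  exists gam, dgam; split=> //.
    by move=> t t01; split=> [|i|i]; [exact: gW | exact: dg | exact: cg].
  move: len; rewrite -RInt_Reals; congr (_ < _); apply: RInt_ext => t.
  rewrite Rmin_left ?Rmax_right; try lra; move=> t01.
  have {}t01 : 0 <= t <= 1 by lra.
  by rewrite (dderiv2_unique (hq t t01) (proj1 hess_g _ _ (gW t t01))) Ropp_involutive.
have speedE : forall t, speed g gam dgam t = sqrt (- - g (gam t) (dgam t)).
  by move=> t; rewrite Ropp_involutive.
exists gam, dgam, (fun t => - g (gam t) (dgam t)); do 2 split=> //.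
split; first by move=> t /hgam [].
split; first by move=> t i /hgam [_ /(_ i)].
split; first by move=> t i /hgam [_ _ /(_ i)].
split; first by move=> t /hgam [Wt _ _]; case: hess_g => hg _; exact: hg.
have pr : Riemann_integrable (fun t => sqrt (- - g (gam t) (dgam t))) 0 1.
  apply: ex_RInt_Reals_0; apply: (ex_RInt_ext (speed g gam dgam)) => [t _|]; first exact: speedE.
  by apply: ex_RInt_speed => //; lra.
by exists pr; rewrite -RInt_Reals -(RInt_ext (speed g gam dgam)).
Qed.

Lemma differential_le_length f df L gam dgam t :
  C1_differential W f df -> 0 <= L ->
  (forall x v, W x -> Rabs (df x v) <= L * sqrt (g x v)) ->
  C1_curve W gam dgam -> 0 <= t <= 1 ->
  Rabs (f (gam t) - f (gam 0)) <= L * RInt (speed g gam dgam) 0 1.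
Proof.
move=> [hf cdf] L0 df_le hgam t01.
have int_0t : ex_RInt (speed g gam dgam) 0 t by apply: ex_RInt_speed => //; lra.
have int_t1 : ex_RInt (speed g gam dgam) t 1 by apply: ex_RInt_speed => //; lra.
have ftc : is_RInt (fun s => df (gam s) (dgam s)) 0 t (f (gam t) - f (gam 0)).
  apply: (is_RInt_derive (fun s => f (gam s)));
    rewrite Rmin_left ?Rmax_right; try lra; move=> s s0t.
    by apply: hf => //; lra.
  by apply/continuity_pt_filterlim; apply: cdf => //; lra.
apply: (Rle_trans _ (L * RInt (speed g gam dgam) 0 t)).
  apply: (norm_RInt_le _ (fun s => L * speed g gam dgam s) 0 t _ _ _ _ ftc); first by lra.
    by move=> s s0t; apply: df_le; case: (hgam s) => //; lra.
  by apply: is_RInt_scal; apply: RInt_correct.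
apply: Rmult_le_compat_l => //; rewrite -(RInt_Chasles _ 0 t 1) // /plus /=.
suff : 0 <= RInt (speed g gam dgam) t 1 by lra.
by apply: RInt_ge_0 => // [|s _]; [lra | exact: sqrt_pos].
Qed.

End HessianLength.

Lemma short_path_endpoint n (W : vec n -> Prop) phi x y eps : short_path W phi x y eps -> W y.
Proof. by move=> [gam [dgam [q [_ [<- [gW _]]]]]]; apply: gW; lra. Qed.

Lemma short_path_sub n (W W' : vec n -> Prop) phi x y eps : (forall z, W z -> W' z) ->
  short_path W phi x y eps -> short_path W' phi x y eps.
Proof.
move=> WW' [gam [dgam [q [g0 [g1 [gW len]]]]]].
by exists gam, dgam, q; do 3 split=> //; move=> t /gW /WW'.
Qed.

Lemma short_path_le n (W : vec n -> Prop) phi x y eps eps' : eps <= eps' ->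
  short_path W phi x y eps -> short_path W phi x y eps'.
Proof.
move=> le_eps [gam [dgam [q [g0 [g1 [gW [dg [cg [hq [pr len]]]]]]]]]].
by exists gam, dgam, q; do 6 split=> //; exists pr; exact: Rlt_le_trans le_eps.
Qed.

Lemma short_path_confined n (W : vec n -> Prop) phi g f df L x y eps :
  neg_hessian W phi g -> C1_differential W f df -> 0 <= L ->
  (forall z v, W z -> Rabs (df z v) <= L * sqrt (g z v)) ->
  short_path W phi x y eps ->
  short_path (fun z => W z /\ Rabs (f z - f x) <= L * eps) phi x y eps.
Proof.
move=> hg hf L0 df_le /(short_pathP hg) [gam [dgam [g0 g1 hgam len]]].
apply/short_pathP; first by apply: neg_hessian_sub hg => z; case.
exists gam, dgam; split=> // t t01; have [Wt d_gam c_dgam] := hgam t t01.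
split=> //; split=> //; rewrite -g0.
apply: Rle_trans (differential_le_length hg hf L0 df_le hgam t01) _.
by apply: Rmult_le_compat_l => //; exact: Rlt_le.
Qed.

Lemma short_path_scal n (W W' : vec n -> Prop) phi phi' g g' r x y eps :
  neg_hessian W phi g -> neg_hessian W' phi' g' -> (forall z, W z -> W' z) -> 0 < r ->
  (forall z v, W z -> g' z v <= r ^ 2 * g z v) ->
  short_path W phi x y eps -> short_path W' phi' x y (r * eps).
Proof.
move=> hg hg' WW' r0 g'_le /(short_pathP hg) [gam [dgam [g0 g1 hgam len]]].
have hgam' := C1_curve_sub WW' hgam.
apply/(short_pathP hg'); exists gam, dgam; split=> //.
apply: Rle_lt_trans (Rmult_lt_compat_l _ _ _ r0 len).
have int_g : ex_RInt (speed g gam dgam) 0 1 by apply: (ex_RInt_speed hg) => //; lra.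
rewrite -[_ * _](RInt_scal (speed g gam dgam)) //; apply: RInt_le; first by lra.
- by apply: (ex_RInt_speed hg') => //; lra.
- exact: ex_RInt_scal.
move=> t t01; have [|Wt _ _] := hgam t; first by lra.
rewrite /scal /= /mult /= /speed -[r]sqrt_pow2; last by lra.
rewrite -sqrt_mult_alt; last exact: pow2_ge_0.
by apply: sqrt_le_1_alt; exact: g'_le.
Qed.

Definition short_path_cauchy {n} (W : vec n -> Prop) (phi : vec n -> R)
    (u : nat -> vec n) : Prop :=
  forall eps, 0 < eps -> exists N : nat, forall m l : nat,
    (N <= m)%nat -> (N <= l)%nat -> short_path W phi (u m) (u l) eps.

Lemma hessian_metric_complete_transfer n (U W : vec n -> Prop) phi psi :
  (forall x, W x -> U x) ->
  (forall x y eps, short_path W psi x y eps -> short_path U phi x y eps) ->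
  (forall u, (forall m, W (u m)) -> short_path_cauchy W psi u ->
     exists r delta (N : nat), [/\ 0 < r, 0 < delta & forall m y eps, (N <= m)%nat ->
       eps <= delta -> short_path U phi (u m) y eps -> short_path W psi (u m) y (r * eps)]) ->
  hessian_metric_complete U phi -> hessian_metric_complete W psi.
Proof.
move=> WU weaken strengthen cplt u Wu cauchy.
have [p [Up lim]] : exists p, U p /\ forall eps, 0 < eps -> exists N : nat, forall m : nat,
    (N <= m)%nat -> short_path U phi (u m) p eps.
  apply: cplt => [m|eps /cauchy [N hN]]; first exact: WU.
  by exists N => m l Nm Nl; apply: weaken; exact: hN.
have [r [delta [N [r0 delta0 hN]]]] := strengthen u Wu cauchy.
have {}lim eps : 0 < eps -> exists N : nat, forall m : nat, (N <= m)%nat ->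
    short_path W psi (u m) p eps.
  move=> eps0; pose d := Rmin delta (eps / r).
  have [|N' hN'] := lim d; first by apply: Rmin_glb_lt => //; exact: Rdiv_lt_0_compat.
  exists (maxn N N') => m; rewrite geq_max => /andP [Nm N'm].
  apply: (@short_path_le _ _ _ _ _ (r * d)); last first.
    by apply: hN (hN' m N'm) => //; exact: Rmin_l.
  by rewrite Rmult_comm; apply/Rcomplements.Rle_div_r => //; exact: Rmin_r.
exists p; split=> //; have [N' hN'] := lim 1 Rlt_0_1.
exact: short_path_endpoint (hN' N' (leqnn N')).
Qed.

(** * The metric of [ln (h + c)] *)

Section LogShift.
Context (n : nat) (U : vec n -> Prop) (h : vec n -> R).
Context (dh : vec n -> vec n) (ddh : vec n -> 'I_n -> vec n).
Hypothesis openU : is_open U.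
Hypothesis jet : C2_jet U h dh ddh.

Definition shift_domain (c : R) (x : vec n) : Prop := U x /\ 0 < h x + c.

Definition log_shift (c : R) (x : vec n) : R := ln (h x + c).

Definition dlog_shift (c : R) (x v : vec n) : R := dot (dh x) v / (h x + c).

Definition log_metric (c : R) (x v : vec n) : R :=
  neg_dln2 (h x + c) (dot (dh x) v) (bilin (ddh x) v v).

Lemma is_derive_log_shift c (g : R -> vec n) dg t :
  shift_domain c (g t) -> curve_derivative g t dg ->
  is_derive (fun s => log_shift c (g s)) t (dlog_shift c (g t) dg).
Proof.
move=> [Ut hc] hg; apply: is_derive_comp (is_derive_ln _ hc) _.
rewrite -[dot _ _]Rplus_0_r; apply: is_derive_plus (is_derive_const _ _).
exact: chain_rule openU (proj1 jet) Ut hg.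
Qed.

Lemma locally_shift_domain c (g : R -> vec n) dg t :
  shift_domain c (g t) -> curve_derivative g t dg -> locally t (fun s => shift_domain c (g s)).
Proof.
move=> [Ut hc] hg.
apply: filter_and; first exact: (locally_open (curve_derivative_continuous hg) openU Ut).
have h_cont : continuous (fun s => h (g s)) t.
  by apply: ex_derive_continuous; eexists; exact: chain_rule openU (proj1 jet) Ut hg.
have near_gt : locally t (fun s => - c < h (g s)).
  by apply: (h_cont (fun y => - c < y)); apply: open_gt; lra.
by apply: filter_imp near_gt => s; lra.
Qed.

Lemma dderiv2_log_shift c x v : shift_domain c x ->
  dderiv2 (log_shift c) x v (- log_metric c x v).
Proof.
move=> Wx; pose y t := vadd x (vscal t v).
have y0 : y 0 = x by exact: vadd_scal0.
have dy t : curve_derivative y t v by exact: line_derivative.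
have Wy0 : shift_domain c (y 0) by rewrite y0.
apply/dderiv2P; exists (fun t => dlog_shift c (y t) v).
  apply: filter_imp (locally_shift_domain Wy0 (dy 0)) => t Wt.
  exact: is_derive_log_shift Wt (dy t).
have [Ux hc] := Wx.
have -> : - log_metric c x v = (bilin (ddh x) v v * (h (y 0) + c) -
    dot (dh (y 0)) v * (dot (dh (y 0)) v + 0)) / (h (y 0) + c) ^ 2.
  by rewrite y0 /log_metric /neg_dln2; field; lra.
apply: is_derive_div; last by rewrite y0; lra.
  by apply: (is_derive_line0 (f := fun z => dot (dh z) v)); exact: C2_jet_dderiv_gradient jet Ux.
apply: is_derive_plus (is_derive_const _ _).
by apply: chain_rule openU (proj1 jet) _ (dy 0); rewrite y0.
Qed.

Section AlongCurve.
Context (c : R) (gam dgam : R -> vec n) (t : R).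
Hypothesis hgam : C1_curve (shift_domain c) gam dgam.
Hypothesis t01 : 0 <= t <= 1.

Lemma continuity_pt_gradient_along f df : C1_gradient U f df ->
  continuity_pt (fun s => dot (df (gam s)) (dgam s)) t.
Proof.
move=> [_ cdf]; have [[Ut _] d_gam c_dgam] := hgam t01.
apply: continuity_pt_dot => // i.
exact: (continuity_pt_along (curve_derivative_continuous d_gam) openU Ut (cdf _ i Ut)).
Qed.

Lemma continuity_pt_div_shift F : continuity_pt F t ->
  continuity_pt (fun s => F s / (h (gam s) + c)) t.
Proof.
move=> cF; have [[Ut hc] d_gam _] := hgam t01.
apply: continuity_pt_div => //; last by lra.
apply: continuity_pt_plus; last exact: continuity_pt_const.
apply: derivable_continuous_pt; eexists; apply/is_derive_Reals.
exact: chain_rule openU (proj1 jet) Ut d_gam.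
Qed.

End AlongCurve.

Lemma C1_differential_log_shift c : C1_differential (shift_domain c) (log_shift c) (dlog_shift c).
Proof.
split=> gam dgam t hgam t01; first by have [Wt d_gam _] := hgam t t01; exact: is_derive_log_shift.
apply: (continuity_pt_div_shift hgam t01).
exact: (continuity_pt_gradient_along hgam t01 (proj1 jet)).
Qed.

Lemma neg_hessian_log_shift c : neg_hessian (shift_domain c) (log_shift c) (log_metric c).
Proof.
split=> [x v|gam dgam t hgam t01]; first exact: dderiv2_log_shift.
have [_ _ c_dgam] := hgam t t01.
apply: continuity_pt_minus.
  apply: (continuity_pt_comp (fun s => dlog_shift c (gam s) (dgam s)) (fun u => u ^ 2)).
    by case: (C1_differential_log_shift c) => _; apply.
  by apply: derivable_continuous_pt; exact: derivable_pt_pow.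
apply: (continuity_pt_div_shift hgam t01).
apply: (continuity_pt_dot (a := fun s i => dot (ddh (gam s) i) (dgam s))) => // i.
exact: (continuity_pt_gradient_along hgam t01 (proj2 jet i)).
Qed.

Section Comparison.
Context (k : R).
Hypothesis k_gt1 : 1 < k.
Hypothesis hess_le : forall x v, U x ->
  bilin (ddh x) v v <= (k - 1) / k * (dot (dh x) v ^ 2 / h x).
Hypothesis h_pos : forall x, U x -> 0 < h x.

Let sqrt_k_gt0 : 0 < sqrt k. Proof. by apply: sqrt_lt_R0; lra. Qed.

Lemma shift_domain0 x : U x -> shift_domain 0 x.
Proof. by move=> Ux; split=> //; have := h_pos Ux; lra. Qed.

Lemma neg_hessian_log_shift0 : neg_hessian U (log_shift 0) (log_metric 0).
Proof. exact: (neg_hessian_sub shift_domain0 (neg_hessian_log_shift 0)). Qed.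

Lemma dlog_shift_le_log_metric c x v : c <= 0 -> shift_domain c x ->
  Rabs (dlog_shift c x v) <= sqrt k * sqrt (log_metric c x v).
Proof.
move=> c0 [Ux hc]; rewrite -sqrt_mult_alt; last by lra.
rewrite -sqrt_Rsqr_abs; apply: sqrt_le_1_alt; rewrite Rsqr_pow2.
by apply: (@dln_sqr_le_neg_dln2 k (h x)) => //; [lra | exact: hess_le].
Qed.

Lemma short_path_log_shift_confined W c x y eps : c <= 0 ->
  (forall z, W z -> shift_domain c z) -> short_path W (log_shift c) x y eps ->
  short_path (fun z => W z /\ Rabs (log_shift c z - log_shift c x) <= sqrt k * eps)
    (log_shift c) x y eps.
Proof.
move=> c0 Wc; apply: (short_path_confined (neg_hessian_sub Wc (neg_hessian_log_shift c))
  (C1_differential_sub Wc (C1_differential_log_shift c)) (Rlt_le _ _ sqrt_k_gt0)).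
by move=> z v /Wc; exact: dlog_shift_le_log_metric.
Qed.

Lemma short_path_unshift c x y eps : c <= 0 ->
  short_path (shift_domain c) (log_shift c) x y eps ->
  short_path U (log_shift 0) x y eps.
Proof.
move=> c0; rewrite -{2}[eps]Rmult_1_l.
apply: (short_path_scal (neg_hessian_log_shift c) neg_hessian_log_shift0); try lra.
  by move=> z [].
move=> z v [Uz hc]; rewrite pow1 Rmult_1_l /log_metric Rplus_0_r.
by apply: (@neg_dln2_antimono k) => //; [lra | exact: hess_le].
Qed.

Lemma log_metric_le_log_metric0 c m x v : c <= 0 -> 0 < m -> U x -> m <= h x + c ->
  log_metric c x v <= k * (1 - c / m) ^ 2 * log_metric 0 x v.
Proof.
move=> c0 m0 Ux hx; rewrite /log_metric Rplus_0_r.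
apply: neg_dln2_le_scal => //; [lra | lra | exact: hess_le | |].
  have : 0 <= - c / m by apply: Rcomplements.Rdiv_le_0_compat; lra.
  by lra.
have : - c * m <= - c * (h x + c) by apply: Rmult_le_compat_l; lra.
move=> ?; apply: (Rmult_le_reg_r m) => //.
by rewrite (_ : _ * _ * m = (m - c) * (h x + c)); [lra | field; lra].
Qed.

Lemma short_path_log_confined_above c e : c <= 0 -> 0 < e ->
  exists delta, 0 < delta /\ forall x y eps, U x -> e <= h x + c -> eps <= delta ->
    short_path U (log_shift 0) x y eps ->
    short_path (fun z => U z /\ e / 2 <= h z + c) (log_shift 0) x y eps.
Proof.
move=> c0 e0; pose gap := ln (e - c) - ln (e / 2 - c).
have gap0 : 0 < gap.
  have : ln (e / 2 - c) < ln (e - c) by apply: ln_increasing; lra.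
  by rewrite /gap; lra.
exists (gap / sqrt k); split=> [|x y eps Ux hx]; first exact: Rdiv_lt_0_compat.
move=> /(Rcomplements.Rle_div_r _ _ _ sqrt_k_gt0); rewrite Rmult_comm => eps_le.
move=> /(short_path_log_shift_confined (Rle_refl 0) shift_domain0).
apply: short_path_sub => z [Uz]; rewrite /log_shift !Rplus_0_r => /Rabs_le_between [lnz _].
split=> //; have hz := h_pos Uz.
have lnx : ln (e - c) <= ln (h x) by apply: Rcomplements.ln_le; lra.
suff : e / 2 - c <= h z by lra.
by apply: Rnot_lt_le => /(ln_increasing _ _ hz); rewrite /gap in eps_le; lra.
Qed.

Lemma short_path_shift c e : c <= 0 -> 0 < e ->
  exists r delta, [/\ 0 < r, 0 < delta & forall x y eps, U x -> e <= h x + c -> eps <= delta ->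
    short_path U (log_shift 0) x y eps ->
    short_path (shift_domain c) (log_shift c) x y (r * eps)].
Proof.
move=> c0 e0; have [delta [delta0 confined]] := short_path_log_confined_above c0 e0.
have ratio0 : 0 < 1 - c / (e / 2).
  have : 0 <= - c / (e / 2) by apply: Rcomplements.Rdiv_le_0_compat; lra.
  by lra.
exists (sqrt k * (1 - c / (e / 2))), delta; split=> //; first exact: Rmult_lt_0_compat.
move=> x y eps Ux hx eps_le /(confined _ _ _ Ux hx eps_le).
apply: short_path_scal (neg_hessian_log_shift c) _ _ _.
- by apply: neg_hessian_sub neg_hessian_log_shift0 => z [].
- by move=> z [Uz hz]; split=> //; lra.
- exact: Rmult_lt_0_compat.
move=> z v [Uz hz]; rewrite Rpow_mult_distr pow2_sqrt; last by lra.
by apply: log_metric_le_log_metric0 => //; lra.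
Qed.

Lemma short_path_cauchy_shift_lower_bound c u : c <= 0 ->
  short_path_cauchy (shift_domain c) (log_shift c) u ->
  exists e (N : nat), 0 < e /\ forall m, (N <= m)%nat -> e <= h (u m) + c.
Proof.
move=> c0 /(_ 1 Rlt_0_1) [N hN].
exists (exp (log_shift c (u N) - sqrt k)), N; split=> [|m Nm]; first exact: exp_pos.
have /(short_path_log_shift_confined c0 (fun _ => id)) := hN N m (leqnn N) Nm.
move=> /short_path_endpoint [[_ hc]].
rewrite Rmult_1_r => /Rabs_le_between [ln_ge _].
apply: Rnot_lt_le => /(ln_increasing _ _ hc); rewrite ln_exp.
by move: ln_ge; rewrite /log_shift; lra.
Qed.

Lemma log_shift_complete c : c <= 0 ->
  hessian_metric_complete U (log_shift 0) ->
  hessian_metric_complete (shift_domain c) (log_shift c).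
Proof.
move=> c0.
apply: hessian_metric_complete_transfer => [x [Ux _]|x y eps|u Wu cauchy].
- by [].
- exact: short_path_unshift.
have [e [N [e0 he]]] := short_path_cauchy_shift_lower_bound c0 cauchy.
have [r [delta [r0 delta0 lift]]] := short_path_shift c0 e0.
exists r, delta, N; split=> // m y eps Nm.
by apply: lift; [case: (Wu m) | exact: he].
Qed.

End Comparison.
End LogShift.

Theorem mainTheorem17 (n : nat) (U : vec n -> Prop) (h : vec n -> R) (k c : R) :
  is_domain U ->
  (forall t x, 0 < t -> U x -> U (vscal t x)) ->
  smooth_on U h ->
  (forall x, U x -> 0 < h x) ->
  1 < k ->
  (forall t x, 0 < t -> U x -> h (vscal t x) = Rpower t k * h x) ->
  (forall x v l, U x -> h x = 1 -> dderiv h x v 0 -> v <> vzero ->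
     dderiv2 h x v l -> 0 < - l) ->
  hessian_metric_complete U (fun x => ln (h x)) ->
  c < 0 ->
  hessian_metric_complete (fun x => U x /\ 0 < h x + c) (fun x => ln (h x + c)).
Proof.
move=> [openU _] cone smooth h_pos k_gt1 hom neg_def cplt c0.
have [dh [ddh jet]] := smooth_on_C2_jet openU smooth.
apply: (log_shift_complete openU jet k_gt1 _ h_pos (Rlt_le _ _ c0)) => [x v Ux|].
  by apply: (hessian_le_gradient_sqr openU cone h_pos _ hom jet neg_def v Ux); lra.
have -> // : log_shift h 0 = (fun x => ln (h x)).
by apply: functional_extensionality => x; rewrite /log_shift Rplus_0_r.
Qed.
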